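(* Let $p$ and $q$ be distinct primes with $q \mid p-1$, let $P$ be an elementary abelian group of order $p^{\alpha}$ and $Q$ an elementary abelian group of order $q^{\beta}$, and let $G = P \rtimes_{\theta} Q$. Let $P_1,\ldots,P_r$ be pairwise non-isomorphic irreducible $\mathbb{Z}_pQ$-modules and let $P = U_1 \times \cdots \times U_r$, where $U_i$ is an isotypic $\mathbb{Z}_pQ$-submodule of $P$ of type $P_i$ and multiplicity $m_i$ for $1 \leq i \leq r$. Let $S$ be a normal subgroup of $G$. Then one of the following holds. (i) $S \leq P$ is a $\mathbb{Z}_pQ$-submodule of $P$. Further, there exists a subset $\{i_1,\ldots,i_s\}$ of $\{1,\ldots,r\}$ such that $S = M_{i_1} \times \cdots \times M_{i_s}$, where each $M_{i_j}$ is a subspace of $U_{i_j}$. (ii) $S \leq \mathrm{Ker}(\theta)$. (iii) $S = \hat{P} \rtimes \hat{Q}$, where $\hat{P} \leq P$ is a $\mathbb{Z}_pQ$-submodule of $P$ containing a complement of $C_P(\hat{Q})$ in $P$, and $\hat{Q}$ is a subgroup of $Q$. Further, there exists a subset $\{l_1,\ldots,l_m\}$ of $\{1,\ldots,r\}$ such that $\hat{P} = W_{l_1} \times \cdots \times W_{l_m}$, where each $W_{l_k}$ is a subspace of $U_{l_k}$. Conversely, the subgroups described in (i), (ii) and (iii) are normal in $G$.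
   Context: $G=P\rtimes_\theta Q$ is the semidirect product with respect to the action homomorphism $\theta: Q\to \mathrm{Aut}(P)$; $P$ is regarded as a $\mathbb{Z}_pQ$-module, where $\mathbb{Z}_p$ is the field with $p$ elements, via this (conjugation) action, and $\mathrm{Ker}(\theta)\le Q$ is viewed as a subgroup of $G$. ''Subspace'' means $\mathbb{Z}_p$-vector subspace. An $R$-module $M$ is isotypic of type $V$ (with $V$ irreducible) if it is isomorphic to a direct sum of copies of $V$; its multiplicity is the number of copies. $C_P(\hat Q)$ is the set of elements of $P$ commuting with every element of $\hat Q$. A complement of $C_P(\hat{Q})$ in $P$ is a subgroup $K\le P$ with $P=C_P(\hat Q)\times K$. $\hat P\rtimes\hat Q$ denotes the internal semidirect product $\hat P\hat Q$. *)

(* Defs.v *)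
From mathcomp Require Import all_boot all_algebra all_fingroup all_solvable all_character.

Set Implicit Arguments.
Unset Strict Implicit.
Unset Printing Implicit Defensive.

Local Open Scope group_scope.

(* The elementary abelian p-group in which these sets live is written           *)
(* multiplicatively: 1 is the zero vector, x * y the sum of x and y, and         *)
(* x ^+ k the product of x by the scalar k : 'F_p.                              *)
Definition is_subspace (gT : finGroupType) (p : nat) (U M : {set gT}) : Prop :=
  [/\ M \subset U, 1 \in M, {in M &, forall x y, x * y \in M}
    & forall k : 'F_p, {in M, forall x, x ^+ k \in M}].

(* x ^ g = g^-1 * x * g is a right action, in line with mx_representation,       *)
(* where group elements act on row vectors by right multiplication.             *)
Definition is_submodule (gT : finGroupType) (p : nat) (Q U M : {set gT}) : Prop :=
  is_subspace p U M /\ {in M & Q, forall x g, x ^ g \in M}.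

(* The direct sum of m copies of the module V afforded by rV is 'M['F_p]_(m, n), *)
(* each of the m rows being a copy of V; its group law is addition. A group     *)
(* morphism from U to it is automatically 'F_p-linear.                          *)
Definition isotypic (gT : finGroupType) (p : nat) (Q : {group gT}) (n : nat)
    (rV : mx_representation 'F_p Q n) (m : nat) (U : {group gT}) : Prop :=
  exists2 f : {morphism U >-> 'M['F_p]_(m, n)},
    isom U [set: 'M['F_p]_(m, n)] f
  & {in U & Q, forall x g, f (x ^ g) = (f x *m rV g)%R}.

Definition prod_of_subspaces (gT : finGroupType) (p r : nat)
    (U : 'I_r -> {group gT}) (S : {set gT}) : Prop :=
  exists (I : {set 'I_r}) (M : 'I_r -> {group gT}),
    (forall i, i \in I -> is_subspace p (U i) (M i))
    /\ \big[dprod/1]_(i in I) M i = S.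

(* Main.v *)
Require Import Defs.
From mathcomp Require Import all_boot all_algebra all_fingroup all_solvable all_character.
From mathcomp Require Import finfield.

(** Since q divides p - 1, every element of Q acts on a 'F_p Q-module as a root
of X^p - X, which splits over 'F_p; by Schur's lemma it acts on an irreducible
module as a scalar ([abelian_irr_scalar]). Hence each irreducible module is a
line on which Q acts by a character Q -> 'F_p, modules that are not isomorphic
have distinct characters ([scalar_irr_rsim]), and an isotypic module U_i is the
whole weight space of its character: each g in Q raises every element of U_i to
one and the same power ([isotypic_scalar_action]).

It follows that a submodule W of P is the direct product of the W :&: U_i
([bigdprod_setI_weights]). Distinct characters are separated by elements of Q,
so composing maps x |-> x ^ g * x ^+ (- a_j g), which preserve W and kill the
j-th component, one reaches any single component of an element of W up to a
nonzero scalar ([annihilate_weights]).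

Let S be normal in G. As P and Q are Hall subgroups, S is the semidirect product
of P :&: S by Qhat = Q :&: S ([normal_coprime_sdprod]), and the commutator group
[P, Qhat] lies in both P and S; by coprime action it is a complement of 'C_P(Qhat)
in P ([coprime_abelian_cent_dprod]). So every normal subgroup has the third
form; the first two are its cases Qhat = 1 and Phat = 1.

For the converse it is enough that P and Q normalise S. The one point that is
not immediate is that P does so in the third form: P is generated by
'C_P(Qhat), which centralises both Qhat and Phat, and by a complement that
lies in S. *)

Set Implicit Arguments.
Unset Strict Implicit.
Unset Printing Implicit Defensive.

Local Open Scope group_scope.

(** * Irreducible modules of an abelian group over a finite field *)

Section Representations.
Import GRing.Theory.
Local Open Scope ring_scope.

(** The minimal polynomial of [A] divides the split polynomial X^#|F| - X and is
not constant. *)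
Lemma expr_card_eigenvalue (F : finFieldType) (n : nat) (A : 'M[F]_n.+1) :
  A ^+ #|F| = A -> exists a, eigenvalue A a.
Proof.
move=> Acard.
have min_dvd : mxminpoly A %| \prod_(x : F) ('X - x%:P).
  rewrite -finField_genPoly; apply: mxminpoly_min.
  by rewrite rmorphB rmorphXn /= horner_mx_X Acard subrr.
have [m eq_min] := dvdp_prod_XsubC min_dvd.
case def_s: (mask m _) eq_min => [|a s] eq_min.
  have := eqp_size eq_min; rewrite big_nil size_poly1 size_mxminpoly => -[].
  by have := mxminpoly_nonconstant A; case: degree_mxminpoly.
exists a; rewrite eigenvalue_root_min (eqp_root eq_min).
by rewrite big_cons rootM root_XsubC eqxx.
Qed.

(** For an eigenvalue [a] of [rQ g], the matrix [rQ g - a%:M] is singular and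
commutes with [rQ], so it vanishes by Schur's lemma. *)
Lemma abelian_irr_scalar (F : finFieldType) (gT : finGroupType)
    (Q : {group gT}) (n : nat) (rQ : mx_representation F Q n) (g : gT) :
    abelian Q -> mx_irreducible rQ -> g \in Q -> (g ^+ #|F|.-1 = 1)%g ->
  exists a, rQ g = a%:M.
Proof.
case: n rQ => [|n] rQ abQ irrQ Qg g_card.
  by case/mx_irrP: irrQ.
have [a /eigenvalueP[v /eqP eig_v nz_v]]: exists a, eigenvalue (rQ g) a.
  apply: expr_card_eigenvalue.
  rewrite -(prednK (ltnW (finNzRing_gt1 F))) exprS -(repr_mxX rQ) // g_card.
  by rewrite repr_mx1 mulr1.
exists a; apply/eqP; rewrite -subr_eq0; apply: contraT => nz_d.
have: rQ g - a%:M \in unitmx.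
  apply: (mx_Schur irrQ) => //; apply/centgmxP=> h Qh.
  rewrite mulmxBl mulmxBr scalar_mxC; congr (_ - _).
  by rewrite -!repr_mxM // (centsP abQ).
move=> unit_d; case/eqP: nz_v; rewrite -[v](mulmxK unit_d).
by rewrite mulmxBr (eqP eig_v) mul_mx_scalar subrr mul0mx.
Qed.

(** Every subspace is a submodule when the action is scalar. *)
Lemma scalar_irr_dim1 (F : fieldType) (gT : finGroupType) (Q : {group gT})
    (n : nat) (rQ : mx_representation F Q n) (a : gT -> F) :
    mx_irreducible rQ -> {in Q, forall g, rQ g = (a g)%:M} -> n = 1%N.
Proof.
move=> /mx_irrP[n_gt0 irrQ] rQa; case: n n_gt0 rQ irrQ rQa => // n _ rQ irrQ rQa.
have /irrQ : mxmodule rQ (<<delta_mx (0 : 'I_1) (0 : 'I_n.+1)>>)%MS.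
  apply/mxmoduleP=> g Qg; rewrite rQa // mul_mx_scalar.
  exact: scalemx_sub.
rewrite -mxrank_eq0 mxrank_gen mxrank_delta => /(_ isT).
by rewrite /row_full mxrank_gen mxrank_delta => /eqP.
Qed.

(** Both modules are lines, and the identity matrix intertwines them. *)
Lemma scalar_irr_rsim (F : fieldType) (gT : finGroupType) (Q : {group gT})
    (n1 n2 : nat) (rQ1 : mx_representation F Q n1)
    (rQ2 : mx_representation F Q n2) (a : gT -> F) :
    mx_irreducible rQ1 -> mx_irreducible rQ2 ->
    {in Q, forall g, rQ1 g = (a g)%:M} -> {in Q, forall g, rQ2 g = (a g)%:M} ->
  mx_rsim rQ1 rQ2.
Proof.
move=> irr1 irr2 rQ1a rQ2a.
have n1_1 := scalar_irr_dim1 irr1 rQ1a; have n2_1 := scalar_irr_dim1 irr2 rQ2a.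
subst n1 n2; exists 1%:M => // [|g Qg]; first by rewrite row_free_unit unitmx1.
by rewrite mulmx1 mul1mx rQ1a ?rQ2a.
Qed.

Lemma isotypic_scalar_action (gT : finGroupType) (p : nat) (Q : {group gT})
    (n : nat) (rV : mx_representation 'F_p Q n) (m : nat) (U : {group gT})
    (a : gT -> 'F_p) :
    {in U & Q, forall x g, (x ^ g)%g \in U} -> isotypic rV m U ->
    {in Q, forall g, rV g = (a g)%:M} ->
  {in U & Q, forall x g, (x ^ g = x ^+ a g)%g}.
Proof.
move=> nUQ [f /isomP[injf _] fQ] rVa x g Ux Qg.
apply: (injmP injf); rewrite ?nUQ ?groupX //.
rewrite fQ // rVa // mul_mx_scalar morphX // FinRing.zmodXgE.
by rewrite -{1}[a g]natr_Zp scaler_nat.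
Qed.

End Representations.

(** * Weight decomposition of submodules *)

Section Exponents.
Variables (gT : finGroupType) (p : nat).
Hypothesis p_prime : prime p.
Implicit Types (x : gT) (a b : 'F_p).

Lemma expg_FpM x a b : x ^+ p = 1 -> x ^+ (a * b)%R = x ^+ a ^+ b.
Proof. by move=> xp1; rewrite -expgM /= expg_mod ?Fp_cast. Qed.

Lemma expg_FpD x a b : x ^+ p = 1 -> x ^+ (a + b)%R = x ^+ a * x ^+ b.
Proof. by move=> xp1; rewrite -expgD /= expg_mod ?Fp_cast. Qed.

Lemma mem_expg_Fp (W : {group gT}) x a :
  x ^+ p = 1 -> a != 0%R -> x ^+ a \in W -> x \in W.
Proof.
move=> xp1 nz_a Wxa; rewrite -[x]/(x ^+ (1%R : 'F_p)) -(GRing.mulfV nz_a).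
by rewrite expg_FpM // groupX.
Qed.

End Exponents.

Section AbelianProducts.
Variables (gT : finGroupType) (P : {group gT}) (I : finType).
Hypothesis abP : abelian P.
Implicit Types c d : I -> gT.

Lemma prodg_expg_abelian c k :
  (forall i, c i \in P) -> \prod_i c i ^+ k = (\prod_i c i) ^+ k.
Proof.
move=> Pc; pose K x y := y \in P /\ x = y ^+ k.
suff [] : K (\prod_i c i ^+ k) (\prod_i c i) by [].
elim/big_rec2: _ => [|i x y _ [Py ->]]; first by split; rewrite ?expg1n.
by split; rewrite ?groupM // expgMn //; apply: (centsP abP).
Qed.

Lemma prodgM_abelian c d :
    (forall i, c i \in P) -> (forall i, d i \in P) ->
  \prod_i (c i * d i) = (\prod_i c i) * (\prod_i d i).
Proof.
move=> Pc Pd.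
suff [] : \prod_i (c i * d i) = (\prod_i c i) * (\prod_i d i)
         /\ \prod_i c i \in P by [].
elim/big_rec3: _ => [|i x y z _ [-> Px]]; first by rewrite mulg1.
split; last by rewrite groupM.
rewrite !mulgA; congr (_ * _); rewrite -!mulgA; congr (_ * _).
exact: (centsP abP).
Qed.

End AbelianProducts.

Section Weights.
Variables (gT : finGroupType) (p r : nat) (Q P : {group gT}).
Variables (U : 'I_r -> {group gT}) (a : 'I_r -> gT -> 'F_p).
Hypothesis p_prime : prime p.
Hypothesis abelP : p.-abelem P.
Hypothesis defP : \big[dprod/1]_(i < r) U i = P.
(* U i is the weight space of the character a i. *)
Hypothesis Uscal : forall i, {in U i & Q, forall x g, x ^ g = x ^+ a i g}.
Hypothesis a_sep : forall i j, i != j -> exists2 g, g \in Q & a i g != a j g.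

Lemma weight_space_sub (i : 'I_r) : U i \subset P.
Proof. by rewrite -(bigdprodWY defP) sub_gen // (bigcup_max i). Qed.

(** Adding an index [j] to [J] composes with x |-> x ^ g * x ^+ (- a j g), where
[g] separates [a i] from [a j]; it multiplies the coefficient [e k] of each
component by [a k g - a j g], which is zero at [j] and not at [i]. *)
Lemma annihilate_weights (W : {group gT}) (c : 'I_r -> gT) (i : 'I_r)
    (J : seq 'I_r) :
    Q \subset 'N(W) -> (forall j, c j \in U j) -> \prod_j c j \in W ->
    i \notin J ->
  exists e : 'I_r -> 'F_p,
    [/\ e i != 0%R, {in J, forall j, e j = 0%R} & \prod_j c j ^+ e j \in W].
Proof.
move=> nWQ Uc Wc; have abP := abelem_abelian abelP; elim: J => [|j J IH].
  exists (fun=> 1%R); split=> //; apply: GRing.oner_neq0.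
rewrite inE negb_or => /andP[ne_ij /IH[e [nz_ei eJ0 We]]].
have Pc k : c k \in P := subsetP (weight_space_sub k) _ (Uc k).
have cp1 k (d : nat) : (c k ^+ d) ^+ p = 1.
  by have [_ ->] := abelemP p_prime abelP; rewrite ?groupX.
have [g Qg ne_a] := a_sep ne_ij.
exists (fun k => e k * (a k g - a j g))%R; split.
- by rewrite GRing.mulf_neq0 // GRing.subr_eq0.
- move=> k; rewrite inE => /predU1P[->|/eJ0->]; last exact: GRing.mul0r.
  by rewrite GRing.subrr GRing.mulr0.
rewrite (eq_bigr (fun k => (c k ^+ e k) ^ g * (c k ^+ e k) ^+ (- a j g)%R)); last first.
  move=> k _; rewrite expg_FpM ?(cp1 k 1%N) // expg_FpD ?cp1 //.
  by rewrite (Uscal (i := k)) ?groupX.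
rewrite (prodgM_abelian abP); first last.
- by move=> k; rewrite !groupX.
- move=> k; apply: subsetP (weight_space_sub k) _ _.
  by rewrite (Uscal (i := k)) ?groupX.
rewrite groupM //; last first.
  by rewrite (prodg_expg_abelian abP) ?groupX // => k; rewrite groupX.
have conjM (x y : gT) := conjMg x y g.
by rewrite -(big_morph (fun x => x ^ g) conjM (conj1g g)) memJ_norm ?(subsetP nWQ).
Qed.

Lemma component_mem (W : {group gT}) (c : 'I_r -> gT) (i : 'I_r) :
    Q \subset 'N(W) -> (forall j, c j \in U j) -> \prod_j c j \in W ->
  c i \in W.
Proof.
move=> nWQ Uc Wc.
have notJi : i \notin [seq j <- enum 'I_r | j != i] by rewrite mem_filter eqxx.
have [e [nz_ei e0 We]] := annihilate_weights nWQ Uc Wc notJi.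
have cip1 : c i ^+ p = 1.
  have [_ ->] // := abelemP p_prime abelP.
  exact: subsetP (weight_space_sub i) _ _.
apply: (mem_expg_Fp p_prime cip1 nz_ei).
suff <- : \prod_j c j ^+ e j = c i ^+ e i by [].
apply: big_only1 => // j ne_ji _.
by rewrite e0 // mem_filter ne_ji mem_enum.
Qed.

Lemma bigdprod_setI_weights (W : {group gT}) :
  W \subset P -> Q \subset 'N(W) -> \big[dprod/1]_(i < r) (W :&: U i) = W.
Proof.
move=> sWP nWQ.
have prodU : (\prod_(i < r) U i)%G = P.
  by apply/val_inj; rewrite /= bigprodGE (bigdprodWY defP).
have /bigdprodYP dirU : \big[dprod/1]_(i < r) U i == (\prod_(i < r) U i)%G.
  by rewrite prodU defP.
have /eqP -> : \big[dprod/1]_(i < r) (W :&: U i) == (\prod_(i < r) (W :&: U i))%G.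
  apply/bigdprodYP=> i _; apply: subset_trans (subset_trans (dirU i isT) _).
    rewrite !bigprodGE genS //; apply/bigcupsP=> j ne_ji.
    by rewrite (bigcup_max j) ?subsetIr.
  by rewrite setDSS ?centS ?setSD ?subsetIr.
apply/eqP; rewrite eqEsubset /= bigprodGE gen_subG.
apply/andP; split; first by apply/bigcupsP=> i _; apply: subsetIl.
apply/subsetP=> x Wx; have [c [Uc x_c _]] := mem_bigdprod defP (subsetP sWP x Wx).
rewrite x_c group_prod // => i _; apply/mem_gen/bigcupP; exists i => //.
rewrite inE Uc // andbT.
apply: (component_mem i nWQ); last by rewrite -x_c.
by move=> j; apply: Uc.
Qed.

End Weights.

(** * Normal subgroups of the semidirect product *)

(** Modulo [~: P, A] the action becomes trivial, and by coprimality the fixed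
points of the quotient lift to fixed points in [P]. *)
Lemma coprime_abelian_cent_dprod (gT : finGroupType) (A P : {group gT}) :
    A \subset 'N(P) -> coprime #|P| #|A| -> abelian P ->
  'C_P(A) \x [~: P, A] = P.
Proof.
move=> nPA coPA abP; have nRP : P \subset 'N([~: P, A]) := commg_norml P A.
have sRP : [~: P, A] \subset P by rewrite commg_subl.
rewrite dprodE /=; first last.
- by rewrite setIAC (setIidPr sRP) coprime_abel_cent_TI.
- by rewrite (centSS sRP (subsetIl _ _)).
rewrite -normC; last by rewrite (subset_trans sRP) ?sub_abelian_norm ?subsetIl.
apply/eqP; rewrite eqEsubset mulG_subG sRP subsetIl /=.
rewrite -quotientSK //= coprime_quotient_cent ?commg_normr ?abelian_sol //.
by rewrite subsetI subxx quotient_cents2r.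
Qed.

Lemma is_submodule_norm (gT : finGroupType) (p : nat) (Q P M : {group gT}) :
  is_submodule p Q P M -> M \subset P /\ Q \subset 'N(M).
Proof.
case=> [[sMP _ _ _] nMQ]; split=> //; apply/normsP=> g Qg; apply/eqP.
rewrite eqEcard cardJg leqnn andbT.
by apply/subsetP=> _ /imsetP[x Mx ->]; apply: nMQ.
Qed.

Lemma group_subspace (gT : finGroupType) (p : nat) (P M : {group gT}) :
  M \subset P -> is_subspace p P M.
Proof. by move=> sMP; split=> // [x y|k x]; [apply: groupM | apply: groupX]. Qed.

Lemma group_submodule (gT : finGroupType) (p : nat) (Q P M : {group gT}) :
  M \subset P -> Q \subset 'N(M) -> is_submodule p Q P M.
Proof.
move=> sMP nMQ; split; first exact: group_subspace.
by move=> x g Mx Qg; rewrite memJ_norm // (subsetP nMQ).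
Qed.

Section NormalSubgroups.
Variables (gT : finGroupType) (p : nat) (G P Q : {group gT}).
Hypotheses (abP : abelian P) (abQ : abelian Q) (defG : P ><| Q = G).

Lemma normal_sdprod (S : {group gT}) :
  P \subset 'N(S) -> Q \subset 'N(S) -> S \subset G -> S <| G.
Proof.
by move=> nSP nSQ sSG; rewrite /normal sSG -(sdprodW defG) mul_subG.
Qed.

Lemma submodule_normal (S : {group gT}) : is_submodule p Q P S -> S <| G.
Proof.
move=> /is_submodule_norm[sSP nSQ]; have [/andP[sPG _] _ _ _ _] := sdprod_context defG.
apply: normal_sdprod => //; last exact: subset_trans sSP sPG.
exact: sub_abelian_norm.
Qed.

Lemma centralizing_normal (S : {group gT}) :
  S \subset Q -> S \subset 'C(P) -> S <| G.
Proof.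
move=> sSQ cPS; have [_ sQG _ _ _] := sdprod_context defG.
apply: normal_sdprod; last exact: subset_trans sSQ sQG.
  by rewrite cents_norm // centsC.
exact: sub_abelian_norm.
Qed.

(** An element of [P] is a product of an element of ['C_P(Qhat)], which
centralises both [Phat] and [Qhat], and an element of [S]. *)
Lemma sdprod_submodule_normal (S Phat Qhat : {group gT}) :
    Phat ><| Qhat = S -> is_submodule p Q P Phat -> Qhat \subset Q ->
    (exists2 K : {group gT}, 'C_P(Qhat) \x K = P & K \subset Phat) ->
  S <| G.
Proof.
move=> defS /is_submodule_norm[sPhP nPhQ] sQhQ [K defP sKPh].
have [/andP[sPG _] sQG _ _ _] := sdprod_context defG.
have [/andP[sPhS _] _ PhQh _ _] := sdprod_context defS.
have sSG : S \subset G.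
  by rewrite -PhQh mul_subG ?(subset_trans sPhP) ?(subset_trans sQhQ).
apply: normal_sdprod => //.
  rewrite -(dprodW defP) mul_subG //.
    rewrite -PhQh normsM //; last by rewrite cents_norm ?subsetIr.
    by rewrite (subset_trans (subsetIl _ _)) ?sub_abelian_norm.
  by rewrite (subset_trans sKPh) // (subset_trans sPhS) ?normG.
by rewrite -PhQh normsM // sub_abelian_norm.
Qed.

(** A Hall subgroup of [G] meets the normal subgroup [S] in a Hall subgroup of
[S]. *)
Lemma normal_coprime_sdprod (S : {group gT}) :
  coprime #|P| #|Q| -> S <| G -> (P :&: S) ><| (Q :&: S) = S.
Proof.
move=> coPQ nsSG; have [nsPG _ _ _ _] := sdprod_context defG.
have hallQ : \pi(Q).-Hall(G) Q.
  by apply: Hall_pi; rewrite -(coprime_sdprod_Hall_r defG).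
have hallP : (\pi(Q)^').-Hall(G) P by apply/(sdprod_normal_pHallP nsPG hallQ).
apply/(sdprod_normal_pHallP _ (Hall_setI_normal nsSG hallQ)).
  by rewrite /= setIC (normalGI (normal_sub nsSG)).
exact: Hall_setI_normal nsSG hallP.
Qed.

End NormalSubgroups.

Theorem corollary4p5 (gT : finGroupType) (p q alpha beta : nat)
    (p_prime : prime p) (q_prime : prime q) (p_neq_q : p != q)
    (q_dvd : q %| p - 1)
    (G P Q : {group gT})
    (abelP : p.-abelem P) (oP : #|P| = (p ^ alpha)%N)
    (abelQ : q.-abelem Q) (oQ : #|Q| = (q ^ beta)%N)
    (theta : {morphism Q >-> {perm gT}})
    (theta_Aut : theta @* Q \subset Aut P)
    (defG : P ><| Q = G)
    (theta_conj : {in P & Q, forall x g, x ^ g = theta g x})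
    (r : nat) (n : 'I_r -> nat)
    (rV : forall i : 'I_r, mx_representation 'F_p Q (n i))
    (rV_irr : forall i : 'I_r, mx_irreducible (rV i))
    (rV_noniso : forall i j : 'I_r, i != j -> ~ mx_rsim (rV i) (rV j))
    (U : 'I_r -> {group gT}) (m : 'I_r -> nat)
    (U_mod : forall i : 'I_r, is_submodule p Q P (U i))
    (U_iso : forall i : 'I_r, isotypic (rV i) (m i) (U i))
    (defP : \big[dprod/1]_(i < r) U i = P)
    (S : {group gT}) :
  S <| G <->
  [\/ is_submodule p Q P S /\ prod_of_subspaces p U S,
      S \subset 'ker theta
    | exists Phat Qhat : {group gT},
        [/\ Phat ><| Qhat = S,
            is_submodule p Q P Phat,
            (exists2 K : {group gT}, 'C_P(Qhat) \x K = P & K \subset Phat),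
            Qhat \subset Q
          & prod_of_subspaces p U Phat]].
Proof.
have abP := abelem_abelian abelP.
have abQ := abelem_abelian abelQ.
have [nsPG sQG _ nPQ _] := sdprod_context defG.
have coPQ : coprime #|P| #|Q|.
  by rewrite oP oQ coprimeXl ?coprimeXr // prime_coprime // dvdn_prime2.
split; last first.
  case=> [[modS _] | sSker | [Phat [Qhat [defS modPh exK sQh _]]]].
  - exact: submodule_normal abP defG _ modS.
  - have sSQ : S \subset Q by apply/subsetP=> g /(subsetP sSker)/dom_ker.
    apply: (centralizing_normal abQ defG) => //.
    rewrite centsC; apply/centsP=> x Px g Sg; apply/commgP/conjg_fixP.
    by rewrite theta_conj ?(subsetP sSQ) // (mker (subsetP sSker g Sg)) perm1.
  exact: (sdprod_submodule_normal abP abQ defG defS modPh sQh exK).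
move=> nsSG; have [sSG nSG] := andP nsSG.
have defS := normal_coprime_sdprod defG coPQ nsSG.
have sPG := normal_sub nsPG.
have sPhP : P :&: S \subset P := subsetIl P S.
have nPhQ : Q \subset 'N(P :&: S) by rewrite normsI ?(subset_trans sQG nSG).
have sQhQ : Q :&: S \subset Q := subsetIl Q S.
(* The third alternative covers every normal subgroup. *)
constructor 3; exists (P :&: S)%G, (Q :&: S)%G; split=> //.
- exact: group_submodule.
- have nPQh := subset_trans sQhQ nPQ.
  (* [P, Qhat] lies in P as Qhat normalises P, and in S as P normalises S. *)
  exists [~: P, (Q :&: S)%G]%G => /=.
    by rewrite coprime_abelian_cent_dprod ?(coprimegS sQhQ).
  rewrite subsetI commg_subl nPQh /=.
  by apply: subset_trans (commgS _ (subsetIr _ _)) _; rewrite commg_subr (subset_trans sPG).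
have scalV i g : exists b, g \in Q -> rV i g = b%:M%R.
  have [Qg | _] := boolP (g \in Q); last by exists 0%R.
  have [|b rVb] := abelian_irr_scalar abQ (rV_irr i) Qg; last by exists b.
  have [_ expQ] := abelemP q_prime abelQ.
  have /dvdnP[k ->] : q %| #|'F_p|.-1 by rewrite card_Fp // -subn1.
  by rewrite mulnC expgM expQ // expg1n.
have [a rVa] := fin_all_exists (fun i => fin_all_exists (scalV i)).
exists setT, (fun i => (P :&: S) :&: U i)%G; split=> [i _|].
  by apply: group_subspace; apply: subsetIr.
rewrite (eq_bigl xpredT) => [|i]; last by rewrite inE.
apply: (bigdprod_setI_weights (a := a) p_prime abelP defP _ _ sPhP nPhQ).
  by move=> i; apply: isotypic_scalar_action (U_iso i) (rVa i); case: (U_mod i).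
move=> i j ne_ij; apply/exists_inP; apply: contraT => no_sep.
case: (rV_noniso i j ne_ij); apply: scalar_irr_rsim (rVa i) _ => // g Qg.
rewrite rVa //; congr (_ %:M)%R; apply/esym/eqP.
by apply: contraNT no_sep => ne_a; apply/exists_inP; exists g.
Qed.
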